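(* Let $H$ be a weighted hypergraph with vertices $v_1,\dots,v_n$ (weights $w_j>0$) and hyperedges $e_1,\dots,e_m$ (weights $u_i>0$), in which every vertex belongs to the support of some hyperedge and every hyperedge has non-empty support. Let $W=\mathrm{diag}(w_1,\dots,w_n)$, $U=\mathrm{diag}(u_1,\dots,u_m)$, and for a support matrix $A$ put $\tilde A=U^{-1/2}AW^{1/2}$. Then $$\max_{H'\subset H}\alpha(H')=\min_{A\in\mathcal S(H)}\|\tilde A^T\tilde A\|,$$ where the maximum is over all subgraphs $H'=(V',E')$ with $V'\neq\emptyset$ and $\|\cdot\|$ is the operator norm induced by the Euclidean norm (equivalently, the largest eigenvalue of the positive semidefinite matrix $\tilde A^T\tilde A$).
   Context: A weighted hypergraph $H=(V,E,\mathrm{supp})$ has a finite vertex set $V=\{v_1,\dots,v_n\}$, a finite hyperedge set $E=\{e_1,\dots,e_m\}$, a support map $\mathrm{supp}:E\to\mathcal P(V)$, and positive weights $\mathrm{wt}(v_j)=w_j$, $\mathrm{wt}(e_i)=u_i$. For $V'\subset V$, $E'\subset E$ put $\mathrm{wt}(V')=\sum_{v\in V'}\mathrm{wt}(v)$, $\mathrm{wt}(E')=\sum_{e\in E'}\mathrm{wt}(e)$. A subgraph of $H$ is a pair $H'=(V',E')$ with $V'\subset V$, $E'\subset E$ and $\mathrm{supp}(e)\subset V'$ for every $e\in E'$; its density is $\alpha(H')=\mathrm{wt}(E')/\mathrm{wt}(V')$. A support matrix of $H$ is a real $m\times n$ matrix $A=(a_{ij})$ with $a_{ij}\ge0$, $a_{ij}=0$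 whenever $v_j\notin\mathrm{supp}(e_i)$, and $\sum_{j=1}^n w_ja_{ij}=u_i$ for all $i$; $\mathcal S(H)$ is the set of support matrices. *)

(* Defs.v *)
From mathcomp Require Import all_boot all_order all_algebra.
From mathcomp Require Import all_classical all_reals.

Set Implicit Arguments.
Unset Strict Implicit.
Unset Printing Implicit Defensive.
Import Order.TTheory GRing.Theory Num.Theory.
Local Open Scope classical_set_scope.
Local Open Scope ring_scope.

(* Vertices and hyperedges are indexed by 'I_n and 'I_m. Since supp is an
   arbitrary map, distinct hyperedges may have the same support. *)
Record whypergraph (R : realType) (n m : nat) := WHypergraph {
  supp : 'I_m -> {set 'I_n};
  vwt : 'I_n -> R;
  ewt : 'I_m -> R;
  vwt_gt0 : forall j, 0 < vwt j;
  ewt_gt0 : forall i, 0 < ewt i }.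

(* A pair (V', E') of a vertex set and a hyperedge set. *)
Definition is_subgraph (R : realType) (n m : nat) (H : whypergraph R n m)
    (G : {set 'I_n} * {set 'I_m}) : Prop :=
  forall i, i \in G.2 -> supp H i \subset G.1.

(* The value is 0 when V' is empty. *)
Definition density (R : realType) (n m : nat) (H : whypergraph R n m)
    (G : {set 'I_n} * {set 'I_m}) : R :=
  (\sum_(i in G.2) ewt H i) / (\sum_(j in G.1) vwt H j).

Definition support_matrices (R : realType) (n m : nat) (H : whypergraph R n m)
    : set 'M[R]_(m, n) :=
  [set A | [/\ forall i j, 0 <= A i j,
               forall i j, j \notin supp H i -> A i j = 0 &
               forall i, \sum_(j < n) vwt H j * A i j = ewt H i]].

(* U^(-1/2) A W^(1/2). *)
Definition tildemx (R : realType) (n m : nat) (H : whypergraph R n m)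
    (A : 'M[R]_(m, n)) : 'M[R]_(m, n) :=
  diag_mx (\row_(i < m) (Num.sqrt (ewt H i))^-1) *m A
    *m diag_mx (\row_(j < n) Num.sqrt (vwt H j)).

(* The library norm on matrices is the sup norm of the entries. *)
Definition l2norm (R : realType) (n : nat) (x : 'cV[R]_n) : R :=
  Num.sqrt (\sum_(i < n) x i 0 ^+ 2).

Definition opnorm (R : realType) (m n : nat) (M : 'M[R]_(m, n)) : R :=
  sup [set l2norm (M *m x) | x in [set x : 'cV[R]_n | l2norm x <= 1]].

Definition is_max (R : realType) (S : set R) (r : R) : Prop :=
  S r /\ ubound S r.

Definition is_min (R : realType) (S : set R) (r : R) : Prop :=
  S r /\ lbound S r.

(* Main.v *)
(** Testing the quadratic form of [tilde A^T tilde A] on [W^(1/2)] times the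
    indicator of [V'] gives [alpha(H') <= norm] for every subgraph and every
    support matrix.  Conversely, let [r] be the maximal density.  Then for every
    vertex set [S] the hyperedges supported in [S] weigh at most [r wt(S)], which
    is the Hall condition for distributing each [u_i] over [supp e_i] without
    exceeding the capacity [r w_j] of any vertex.  A feasible distribution is a
    support matrix with column sums at most [r], and the Schur test bounds its
    norm by [r]. *)

Require Import Defs.
From mathcomp Require Import all_boot all_order all_algebra.
From mathcomp Require Import all_classical all_reals.
From mathcomp Require Import ring lra.
Import Order.TTheory GRing.Theory Num.Theory.
Local Open Scope classical_set_scope.
Local Open Scope ring_scope.

(** Lagrange's identity: the double sum of the squares [(p i * q j - p j * q i) ^+ 2] is twice the
    defect of the inequality. *)
Lemma cauchy_schwarz_sum (R : realDomainType) (I : finType) (p q : I -> R) :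
  (\sum_i p i * q i) ^+ 2 <= (\sum_i p i ^+ 2) * (\sum_i q i ^+ 2).
Proof.
have : 0 <= \sum_i \sum_j (p i * q j - p j * q i) ^+ 2.
  by apply: sumr_ge0 => i _; apply: sumr_ge0 => j _; apply: sqr_ge0.
have -> : \sum_i \sum_j (p i * q j - p j * q i) ^+ 2 =
    ((\sum_i p i ^+ 2) * (\sum_i q i ^+ 2) - (\sum_i p i * q i) ^+ 2) *+ 2.
  have e i j : (p i * q j - p j * q i) ^+ 2 =
      p i ^+ 2 * q j ^+ 2 + q i ^+ 2 * p j ^+ 2 - (p i * q i) * (p j * q j) *+ 2.
    by ring.
  under eq_bigr do under eq_bigr do rewrite e.
  under eq_bigr do rewrite sumrB big_split sumrMnl -!big_distrr /=.
  rewrite sumrB big_split sumrMnl -!big_distrl /=; ring.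
by rewrite pmulrn_lge0 // subr_ge0.
Qed.

(** * Transportation of demands under a Hall condition *)

Section Transport.
Variables (R : realDomainType) (I J : finType).
Implicit Types (D : I -> {set J}) (u : I -> R) (c : J -> R).

Definition demand D u (S : {set J}) : R := \sum_(i | D i \subset S) u i.

Definition hall D u c := forall S, demand D u S <= \sum_(j in S) c j.

Lemma sum_setUI c (S T : {set J}) :
  \sum_(j in S :|: T) c j + \sum_(j in S :&: T) c j =
  \sum_(j in S) c j + \sum_(j in T) c j.
Proof.
rewrite ![\sum_(j in _) _]big_mkcond -!big_split /=; apply: eq_bigr => j _.
by rewrite !inE; case: (j \in S); case: (j \in T); rewrite ?addr0 ?add0r.
Qed.

Lemma demandD1 D u i S :
  demand D u S = (D i \subset S)%:R * u i + \sum_(k | (k != i) && (D k \subset S)) u k.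
Proof.
rewrite /demand; case: (boolP (D i \subset S)) => iS.
  by rewrite (bigD1 i) //= mul1r; congr (_ + _); apply: eq_bigl => k; rewrite andbC.
rewrite mul0r add0r; apply: eq_bigl => k.
by case: eqVneq => [->|//]; apply/negbTE.
Qed.

(** Supermodularity: a set inside [S] or [T] lies in the union, and one inside both lies in the
    intersection. The predicate [P] allows one index to be left out. *)
Lemma demand_setUI D u (P : pred I) (S T : {set J}) : (forall i, 0 <= u i) ->
  \sum_(i | P i && (D i \subset S)) u i + \sum_(i | P i && (D i \subset T)) u i <=
  \sum_(i | P i && (D i \subset S :|: T)) u i +
  \sum_(i | P i && (D i \subset S :&: T)) u i.
Proof.
move=> u0; rewrite !big_mkcondr -!big_split /=; apply: ler_sum => i _.
rewrite finset.subsetI; have := u0 i.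
case: (boolP (D i \subset S)) => iS /=; last first.
  case: (boolP (D i \subset T)) => iT /= => [_|]; last by case: ifP => _ ?; lra.
  by rewrite (fintype.subset_trans iT (finset.subsetUr _ _)); lra.
rewrite (fintype.subset_trans iS (finset.subsetUl _ _)).
by case: ifP => _; lra.
Qed.

(* Choose the amount [t] of the demand of [i] that is to be met by [j]: the
   lower bounds on [t] come from sets avoiding [j], the upper bounds from sets
   containing [j], and supermodularity of the demand makes them compatible. *)
Lemma hall_move D u c i j : (forall k, 0 <= u k) -> hall D u c -> j \in D i ->
  exists2 t, 0 <= t <= u i &
    hall (fun k => if k == i then D i :\ j else D k)
         (fun k => if k == i then u i - t else u k)
         (fun k => if k == j then c j - t else c k).
Proof.
move=> u0 Hall ji.
pose v (S : {set J}) := \sum_(k | (k != i) && (D k \subset S)) u k.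
have v0 S : 0 <= v S by apply: sumr_ge0.
(* Once [j] serves [t] units of [i], a set [S] avoiding [j] and containing [D i :\ j] must carry
   [u i - t + v S], which forces [low S <= t]. *)
pose low (S : {set J}) := u i + v S - \sum_(k in S) c k.
pose lows (S : {set J}) := (j \notin S) && (D i :\ j \subset S).
pose t := \big[Order.max/0]_(S | lows S) low S.
have dE S : demand D u S = (D i \subset S)%:R * u i + v S by apply: demandD1.
have vc S : v S <= \sum_(k in S) c k.
  by apply: le_trans (Hall S); rewrite dE lerDr mulr_ge0.
have t0 : 0 <= t by apply: bigmax_ge_id.
have tu : t <= u i.
  by apply: bigmax_le => // S _; rewrite /low; have := vc S; lra.
exists t; first by rewrite t0.
(* If [D i] lies in [T], demand and capacity of [T] both drop by [t]; only the other sets containing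
   [j] bound [t] from above. *)
have tT (T : {set J}) : j \in T -> t <= \sum_(k in T) c k - v T \/ D i \subset T.
  move=> jT; case: (boolP (D i \subset T)) => iT; [by right|left].
  apply: bigmax_le => [|S /andP[jS iS]]; first by have := vc T; lra.
  have iST : D i \subset S :|: T.
    apply/fintype.subsetP => k ki; rewrite inE; case: (eqVneq k j) => [->|kj].
      by rewrite jT orbT.
    by rewrite (fintype.subsetP iS) // !inE kj.
  (* The union contains [D i], so Hall's condition there charges [u i]; with [vc] on the
     intersection this gives [low S <= \sum_(k in T) c k - v T]. *)
  have := demand_setUI D u (fun k => k != i) S T u0.
  rewrite -/(v S) -/(v T) -/(v (S :|: T)) -/(v (S :&: T)).
  have := sum_setUI c S T; have := Hall (S :|: T); have := vc (S :&: T).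
  rewrite dE iST mul1r /low; lra.
move=> S; rewrite (demandD1 _ _ i) eqxx.
have -> : \sum_(k | (k != i) && ((if k == i then D i :\ j else D k) \subset S))
    (if k == i then u i - t else u k) = v S.
  by rewrite /v; apply: eq_big => k; case: (k == i).
case: (boolP (j \in S)) => jS.
  have -> : \sum_(k in S) (if k == j then c j - t else c k) = \sum_(k in S) c k - t.
    rewrite (bigD1 j jS) /= eqxx [in RHS](bigD1 j jS) /= addrAC; congr (_ + _ - _).
    by apply: eq_bigr => k /andP[_ /negbTE->].
  have -> : (D i :\ j \subset S) = (D i \subset S).
    by rewrite finset.subDset (finset.setUidPr _) // finset.sub1set.
  have := tT S jS; have := Hall S; rewrite dE.
  by case: (D i \subset S) => /=; [lra | move=> _ []//; lra].
have -> : \sum_(k in S) (if k == j then c j - t else c k) = \sum_(k in S) c k.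
  by apply: eq_bigr => k kS; case: eqVneq => // kj; rewrite -kj kS in jS.
case: (boolP (D i :\ j \subset S)) => iS; last by rewrite mul0r add0r.
rewrite mul1r -addrA -[_ + v S]addrC addrA.
have : low S <= t by apply: le_bigmax_cond; rewrite /lows jS.
rewrite /low; lra.
Qed.

(** Induction on the number of pairs [(i, j)] with [j \in D i]: [hall_move] fixes the amount sent
    along one pair and deletes that pair. *)
Lemma transportation D u c : (forall i, 0 <= u i) -> hall D u c ->
  exists f : I -> J -> R,
    [/\ forall i j, 0 <= f i j, forall i j, j \notin D i -> f i j = 0,
        forall i, \sum_j f i j = u i & forall j, \sum_i f i j <= c j].
Proof.
have [N] := ubnP (\sum_i #|D i|)%N.
elim: N => // N IH in D u c *.
rewrite ltnS => DN u0 Hall.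
have [[i Di]|D0] : (exists i, D i != finset.set0) \/ (forall i, D i = finset.set0).
  case: (pickP (fun i => D i != finset.set0)) => [i ?|D0]; first by left; exists i.
  by right=> i; apply/eqP/negPn; rewrite D0.
  have [j ji] := finset.set0Pn _ Di.
  have [t /andP[t0 tu]] := hall_move D u c i j u0 Hall ji.
  set D' := (X in hall X _ _) => Hall'.
  case: (IH _ _ _ _ _ Hall') => [|k|f [f0 fD fu fc]].
  - apply: leq_trans DN.
    rewrite [X in (X < _)%N](bigD1 i) // [X in (_ < X)%N](bigD1 i) //= /D' eqxx.
    rewrite -addSn (cardsD1 j (D i)) ji leq_add2l.
    by apply: leq_sum => k /negbTE->.
  - by case: eqP => _; rewrite ?subr_ge0.
  exists (fun k l => f k l + ((k == i) && (l == j))%:R * t); split=> [k l|k l kl|k|l].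
  - by rewrite addr_ge0 ?mulr_ge0.
  - have -> : (k == i) && (l == j) = false.
      by apply: contraNF kl => /andP[/eqP-> /eqP->].
    rewrite mul0r addr0 fD // /D'; case: eqP kl => // ->.
    by rewrite !inE => /negbTE->; rewrite andbF.
  - rewrite big_split -big_distrl /= fu; case: (eqVneq k i) => [->|_] /=.
      by rewrite (bigD1 j) //= eqxx big1 ?addr0 ?mul1r ?subrK // => l /negbTE->.
    by rewrite big1 // mul0r addr0.
  - rewrite big_split -big_distrl /=; have := fc l; case: (eqVneq l j) => [->|_] /=.
      rewrite [X in X * t](_ : _ = 1) ?mul1r ?lerBrDr //.
      by rewrite (bigD1 i) //= eqxx big1 ?addr0 // => k /negbTE->.
    by rewrite [X in X * t]big1 ?mul0r ?addr0 // => k; rewrite andbF.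
(* With every [D i] empty, each [S] carries the whole demand: the empty set forces [u = 0], and
   singletons then give [0 <= c j]. *)
have fin0 (S : {set J}) : \sum_i u i <= \sum_(j in S) c j.
  by apply: le_trans (Hall S); rewrite /demand;
    under [leRHS]eq_bigl do rewrite D0 finset.sub0set.
have u_eq0 i : u i = 0.
  apply/eqP; rewrite eq_le u0 andbT; apply: le_trans (_ : \sum_i u i <= 0).
    by rewrite (bigD1 i) //= lerDl sumr_ge0.
  by have := fin0 finset.set0; rewrite big_set0.
exists (fun _ _ => 0); split=> // [i|j]; rewrite big1 //.
by have := fin0 [set j]%SET; rewrite big_set1 big1.
Qed.
End Transport.

(** * Inner product, operator norm and spectrum of Gram matrices *)

Section Dot.
Local Set Implicit Arguments.
Local Unset Strict Implicit.
Variable R : realType.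

Definition dot n (x y : 'cV[R]_n) : R := (x^T *m y) 0 0.

Lemma dot_sum n (x y : 'cV[R]_n) : dot x y = \sum_i x i 0 * y i 0.
Proof. by rewrite /dot mxE; apply: eq_bigr => i _; rewrite mxE. Qed.

Lemma dotC n (x y : 'cV[R]_n) : dot x y = dot y x.
Proof. by rewrite !dot_sum; apply: eq_bigr => i _; rewrite mulrC. Qed.

Lemma dotDl n (x y z : 'cV[R]_n) : dot (x + y) z = dot x z + dot y z.
Proof. by rewrite /dot raddfD mulmxDl mxE. Qed.

Lemma dotZl n a (x y : 'cV[R]_n) : dot (a *: x) y = a * dot x y.
Proof. by rewrite /dot linearZ -scalemxAl mxE. Qed.

Lemma dotDr n (x y z : 'cV[R]_n) : dot x (y + z) = dot x y + dot x z.
Proof. by rewrite dotC dotDl !(dotC x). Qed.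

Lemma dotZr n a (x y : 'cV[R]_n) : dot x (a *: y) = a * dot x y.
Proof. by rewrite dotC dotZl dotC. Qed.

Lemma dot_mulmx m n (A : 'M[R]_(m, n)) x y : dot (A *m x) y = dot x (A^T *m y).
Proof. by rewrite /dot trmx_mul -mulmxA. Qed.

Lemma dot_ge0 n (x : 'cV[R]_n) : 0 <= dot x x.
Proof. by rewrite dot_sum sumr_ge0 // => i _; rewrite -expr2 sqr_ge0. Qed.

Lemma dot_eq0 n (x : 'cV[R]_n) : (dot x x == 0) = (x == 0).
Proof.
apply/idP/eqP => [|->]; last by rewrite /dot mulmx0 mxE.
rewrite dot_sum psumr_eq0 => [/allP x0|i _]; last by rewrite -expr2 sqr_ge0.
apply/colP => i; apply/eqP; rewrite mxE.
by have := x0 i (mem_index_enum _); rewrite mulf_eq0 orbb.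
Qed.

Lemma dot_gt0 n (x : 'cV[R]_n) : (0 < dot x x) = (x != 0).
Proof. by rewrite lt_neqAle dot_ge0 andbT eq_sym dot_eq0. Qed.

Lemma dot_cauchy_schwarz n (x y : 'cV[R]_n) : dot x y ^+ 2 <= dot x x * dot y y.
Proof. by rewrite !dot_sum; exact: cauchy_schwarz_sum. Qed.

Lemma l2normE n (x : 'cV[R]_n) : l2norm x = Num.sqrt (dot x x).
Proof. by rewrite dot_sum; congr Num.sqrt; apply: eq_bigr => i _; rewrite expr2. Qed.

(** The squared Frobenius norm serves as constant, by Cauchy-Schwarz on each row. *)
Lemma dot_mulmx_bounded m n (A : 'M[R]_(m, n)) :
  exists2 C, 0 <= C & forall x, dot (A *m x) (A *m x) <= C * dot x x.
Proof.
exists (\sum_i dot (row i A)^T (row i A)^T) => [|x].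
  by apply: sumr_ge0 => i _; apply: dot_ge0.
rewrite [leLHS]dot_sum mulr_suml; apply: ler_sum => i _.
suff -> : (A *m x) i 0 = dot (row i A)^T x by rewrite -expr2 dot_cauchy_schwarz.
by rewrite mxE dot_sum; apply: eq_bigr => j _; rewrite !mxE.
Qed.

Lemma opnorm_has_ubound m n (A : 'M[R]_(m, n)) :
  has_ubound [set l2norm (A *m x) | x in [set x : 'cV[R]_n | l2norm x <= 1]].
Proof.
have [C C0 CA] := dot_mulmx_bounded A.
exists (Num.sqrt C) => _ [x /= x1 <-]; rewrite l2normE ler_wsqrtr //.
apply: le_trans (CA x) _; apply: ler_piMr => //.
by rewrite -(sqr_sqrtr (dot_ge0 _)) -l2normE expr_le1 // sqrtr_ge0.
Qed.

Lemma opnorm_ge0 m n (A : 'M[R]_(m, n)) : 0 <= opnorm A.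
Proof.
apply: (ub_le_sup (opnorm_has_ubound A)); exists 0 => /=; last first.
  by rewrite mulmx0 l2normE /dot mulmx0 mxE sqrtr0.
by rewrite l2normE /dot mulmx0 mxE sqrtr0.
Qed.

Lemma opnorm_bound m n (A : 'M[R]_(m, n)) x :
  dot (A *m x) (A *m x) <= opnorm A ^+ 2 * dot x x.
Proof.
have [->|x0] := eqVneq x 0; first by rewrite /dot !mulmx0 mxE mulr0.
have xx0 : 0 < dot x x by rewrite dot_gt0.
pose s := (Num.sqrt (dot x x))^-1.
have s2 : s ^+ 2 * dot x x = 1.
  by rewrite exprVn sqr_sqrtr ?dot_ge0 // mulVf // gt_eqF.
have : l2norm (A *m (s *: x)) <= opnorm A.
  apply: (ub_le_sup (opnorm_has_ubound A)); exists (s *: x) => //=.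
  by rewrite l2normE dotZl dotZr mulrA -expr2 s2 sqrtr1.
rewrite l2normE => /(lerXn2r 2).
rewrite !nnegrE sqrtr_ge0 opnorm_ge0 => /(_ isT isT).
rewrite sqr_sqrtr ?dot_ge0 // -scalemxAr dotZl dotZr mulrA -expr2 => le.
rewrite -[leLHS]mul1r -s2 mulrAC; apply: ler_wpM2r => //; exact: ltW.
Qed.

Lemma opnorm_le m n (A : 'M[R]_(m, n)) c : 
  (forall x, dot (A *m x) (A *m x) <= c * dot x x) -> opnorm A <= Num.sqrt c.
Proof.
move=> Ac; apply: ge_sup; first by exists (l2norm (A *m 0)), 0 => //=;
  rewrite l2normE /dot mulmx0 mxE sqrtr0.
move=> _ [x /= x1 <-]; rewrite l2normE.
have [c0|c0] := leP 0 c.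
  rewrite ler_wsqrtr //; apply: le_trans (Ac x) _; apply: ler_piMr => //.
  by rewrite -(sqr_sqrtr (dot_ge0 _)) -l2normE expr_le1 // sqrtr_ge0.
(* For negative [c] the root is 0 by convention, and the hypothesis leaves no room for a nonzero
   image. *)
rewrite (ler0_sqrtr (ltW c0)) ler0_sqrtr //; apply: le_trans (Ac x) _.
by rewrite mulr_le0_ge0 ?dot_ge0 // ltW.
Qed.

(* If the form [q x = x^T N x] is nonnegative and at most [k |x|^2], evaluating
   it at [k x - N x] yields [|N x|^2 <= k q x]. *)
Lemma psd_unit_coercive n (N : 'M[R]_n) : N^T = N ->
  (forall x, 0 <= dot x (N *m x)) -> N \in unitmx ->
  exists2 c, 0 < c & forall x, c * dot x x <= dot x (N *m x).
Proof.
move=> Nsym N0 Nu.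
have [K K0 NK] := dot_mulmx_bounded N.
have [C C0 NC] := dot_mulmx_bounded (invmx N).
pose k := 1 + K; pose d := 1 + C.
have k0 : 0 < k by rewrite /k; lra.
have d0 : 0 < d by rewrite /d; lra.
(* Expanding [|y - N y|^2 >= 0] bounds twice the form by [(1 + K) |y|^2]. *)
have quad_le y : dot y (N *m y) <= k * dot y y.
  have := dot_ge0 (y + (-1) *: (N *m y)); have := NK y; have := dot_ge0 y.
  have := mulr_ge0 K0 (dot_ge0 y).
  rewrite dotDl !dotDr !dotZl !dotZr (dotC (N *m y) y) /k; lra.
exists (d * k)^-1 => [|x]; first by rewrite invr_gt0 mulr_gt0.
rewrite ler_pdivrMl ?mulr_gt0 // -mulrA.
have Nx_le : dot (N *m x) (N *m x) <= k * dot x (N *m x).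
  set y := N *m x.
  have := N0 (k *: x + (-1) *: y); have := quad_le y; have := k0.
  rewrite mulmxDr -!scalemxAr dotDl !dotDr !dotZl !dotZr -/y.
  have -> : dot x (N *m y) = dot y y by rewrite -[in LHS]Nsym -dot_mulmx.
  move=> k0' yy pos; rewrite -(ler_pM2l k0'); nra.
(* Writing [x] as the inverse of [N] applied to [N x] bounds [|x|^2] by [C |N x|^2]. *)
have := NC (N *m x); rewrite mulKmx // => /le_trans; apply.
apply: le_trans (_ : d * dot (N *m x) (N *m x) <= _); last by rewrite ler_pM2l.
by rewrite ler_wpM2r ?dot_ge0 // /d lerDr.
Qed.

(** [eigenvalue] refers to row vectors; symmetry lets them be transposed into columns. *)
Lemma eigenvalue_symP n (M : 'M[R]_n) a : M^T = M ->
  reflect (exists2 x : 'cV_n, M *m x = a *: x & x != 0) (eigenvalue M a).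
Proof.
move=> Msym; apply: (iffP eigenvalueP) => -[v Mv v0]; exists v^T.
- by rewrite -[M]Msym -trmx_mul Mv linearZ.
- by rewrite trmx_eq0.
- by rewrite -[M]Msym -trmx_mul Mv linearZ.
- by rewrite trmx_eq0.
Qed.

Lemma eigenvalue_unitmx n (M : 'M[R]_n) a :
  eigenvalue M a = (M - a%:M \notin unitmx).
Proof. by rewrite /eigenvalue /eigenspace kermx_eq0 row_free_unit. Qed.

Lemma dot_eigenvector m n (B : 'M[R]_(m, n)) a x :
  (B^T *m B) *m x = a *: x -> dot (B *m x) (B *m x) = a * dot x x.
Proof. by move=> Bx; rewrite dot_mulmx mulmxA Bx dotZr. Qed.

Lemma gram_eigenvalue_ge0 m n (B : 'M[R]_(m, n)) a :
  eigenvalue (B^T *m B) a -> 0 <= a.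
Proof.
have Msym : (B^T *m B)^T = B^T *m B by rewrite trmx_mul trmxK.
move=> /(eigenvalue_symP _ Msym)[x /dot_eigenvector Bx x0].
by rewrite -(pmulr_lge0 a (_ : 0 < dot x x)) ?dot_gt0 // -Bx dot_ge0.
Qed.

(* With [lam] the norm, [lam^2 - M^2] is positive semidefinite; were it
   invertible it would be coercive, and the norm would be less than [lam]. *)
Lemma opnorm_gram_eigenvalue m n (B : 'M[R]_(m, n)) : (0 < n)%N ->
  eigenvalue (B^T *m B) (opnorm (B^T *m B)).
Proof.
move=> n0; set M := B^T *m B; set lam := opnorm M.
have Msym : M^T = M by rewrite trmx_mul trmxK.
have lam0 : 0 <= lam by apply: opnorm_ge0.
pose N := (lam ^+ 2)%:M - M *m M.
have NE x : dot x (N *m x) = lam ^+ 2 * dot x x - dot (M *m x) (M *m x).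
  rewrite mulmxBl mul_scalar_mx -scaleN1r dotDr !dotZr -mulmxA mulN1r.
  by rewrite [in RHS]dot_mulmx Msym.
have Nnu : N \notin unitmx.
  apply/negP => Nu; have [|x|c c0 Nc] := @psd_unit_coercive _ N _ _ Nu.
  - by rewrite /N linearB /= tr_scalar_mx trmx_mul Msym.
  - by rewrite NE subr_ge0 opnorm_bound.
  have Mc x : dot (M *m x) (M *m x) <= (lam ^+ 2 - c) * dot x x.
    by have := Nc x; rewrite NE; lra.
  (* Ensures that the root of [lam ^+ 2 - c] is not truncated to 0; a nonzero test vector exists
     since [0 < n]. *)
  have c_le : c <= lam ^+ 2.
    have x0 : 0 < dot (const_mx 1 : 'cV[R]_n) (const_mx 1).
      rewrite dot_gt0; apply/eqP => /colP /(_ (Ordinal n0)) /eqP.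
      by rewrite !mxE oner_eq0.
    rewrite -subr_ge0 -(pmulr_lge0 _ x0); exact: le_trans (dot_ge0 _) (Mc _).
  have := opnorm_le Mc.
  rewrite -/lam => /(lerXn2r 2).
  rewrite !nnegrE lam0 sqrtr_ge0 sqr_sqrtr ?subr_ge0 // => /(_ isT isT); lra.
(* Singularity of [N] makes [lam] or [- lam] an eigenvalue; a Gram matrix has no negative one, so in
   the second case [lam = 0]. *)
have NM : N = (-1 *: (M - lam%:M)) *m (M - (- lam)%:M).
  rewrite -scalemxAl mulmxBr !mulmxBl raddfN /= !mulmxN !mul_mx_scalar mul_scalar_mx.
  rewrite scale_scalar_mx scaleN1r -expr2 /N opprK.
  by rewrite [RHS]opprD opprB; apply/matrixP => i j; rewrite !mxE; ring.
move: Nnu; rewrite NM unitmx_mul unitmxZ ?unitrN1 // negb_and.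
rewrite -!eigenvalue_unitmx => /orP[//|eNlam].
have := gram_eigenvalue_ge0 eNlam; rewrite oppr_ge0 => lam_le0.
have lam_eq0 : lam = 0 by apply/eqP; rewrite eq_le lam_le0.
by move: eNlam; rewrite lam_eq0 oppr0.
Qed.

Lemma opnorm_gram_max m n (B : 'M[R]_(m, n)) : (0 < n)%N ->
  is_max [set l : R | eigenvalue (B^T *m B) l] (opnorm (B^T *m B)).
Proof.
move=> n0; split => [|a /= ea]; first exact: opnorm_gram_eigenvalue.
have a0 := gram_eigenvalue_ge0 ea.
have Msym : (B^T *m B)^T = B^T *m B by rewrite trmx_mul trmxK.
have [x Bx x0] := eigenvalue_symP _ Msym ea.
have := opnorm_bound (B^T *m B) x.
rewrite Bx dotZl dotZr mulrA ler_pM2r ?dot_gt0 // -expr2.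
by rewrite ler_pXn2r // nnegrE opnorm_ge0.
Qed.

(** The norm is itself an eigenvalue, so it suffices to evaluate the form at an eigenvector for
    it. *)
Lemma opnorm_gram_le m n (B : 'M[R]_(m, n)) r : (0 < n)%N ->
  (forall x, dot (B *m x) (B *m x) <= r * dot x x) -> opnorm (B^T *m B) <= r.
Proof.
move=> n0 Br; have Msym : (B^T *m B)^T = B^T *m B by rewrite trmx_mul trmxK.
have [x /dot_eigenvector Bx x0] :=
  eigenvalue_symP _ Msym (opnorm_gram_eigenvalue B n0).
by have := Br x; rewrite Bx ler_pM2r ?dot_gt0.
Qed.

Lemma dot_mulmx_le_opnorm_gram m n (B : 'M[R]_(m, n)) x :
  dot (B *m x) (B *m x) <= opnorm (B^T *m B) * dot x x.
Proof.
rewrite dot_mulmx mulmxA; set M := B^T *m B.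
apply: le_trans (ler_norm _) _.
rewrite -ler_sqr ?nnegrE ?mulr_ge0 ?opnorm_ge0 ?dot_ge0 // real_normK ?num_real //.
apply: le_trans (dot_cauchy_schwarz _ _) _.
rewrite exprMn mulrC [leRHS](_ : _ = opnorm M ^+ 2 * dot x x * dot x x); last by ring.
by rewrite ler_wpM2r ?dot_ge0 // opnorm_bound.
Qed.
End Dot.

(** * Support matrices and subgraph densities *)

Section Support.
Local Set Implicit Arguments.
Local Unset Strict Implicit.
Variables (R : realType) (n m : nat) (H : whypergraph R n m).
Implicit Types (A : 'M[R]_(m, n)) (G : {set 'I_n} * {set 'I_m}).

Lemma tildemxE A i j :
  tildemx H A i j = (Num.sqrt (ewt H i))^-1 * A i j * Num.sqrt (vwt H j).
Proof. by rewrite /tildemx mul_mx_diag mxE mul_diag_mx !mxE. Qed.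

Lemma vwt_sum_gt0 (S : {set 'I_n}) : S != finset.set0 -> 0 < \sum_(j in S) vwt H j.
Proof.
move=> /finset.set0Pn[j jS]; rewrite (bigD1 j) //= ltr_pwDl ?vwt_gt0 //.
by apply: sumr_ge0 => k _; apply: ltW; apply: vwt_gt0.
Qed.

(* Test the quadratic form on [W^(1/2)] times the indicator of [V']. *)
Lemma density_le_opnorm A G : support_matrices H A -> is_subgraph H G ->
  G.1 != finset.set0 -> density H G <= opnorm ((tildemx H A)^T *m tildemx H A).
Proof.
move=> [A0 Asupp Asum] sub G0.
rewrite /density ler_pdivrMr ?vwt_sum_gt0 //.
pose x : 'cV[R]_n := \col_j (if j \in G.1 then Num.sqrt (vwt H j) else 0).
have xx : dot x x = \sum_(j in G.1) vwt H j.
  rewrite dot_sum [RHS]big_mkcond; apply: eq_bigr => j _; rewrite !mxE.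
  by case: ifP => _; rewrite ?mulr0 // -expr2 sqr_sqrtr // ltW // vwt_gt0.
(* Cutting off outside [G.1] loses nothing in such a row, as [A i j] vanishes off [supp H i]; the
   full weighted row sum [ewt H i] remains. *)
have Ax i : i \in G.2 -> (tildemx H A *m x) i 0 = Num.sqrt (ewt H i).
  move=> iG; rewrite mxE.
  transitivity (\sum_j (Num.sqrt (ewt H i))^-1 * (vwt H j * A i j)).
    apply: eq_bigr => j _; rewrite tildemxE mxE; case: ifPn => jG.
      by rewrite -!mulrA -expr2 sqr_sqrtr ?(ltW (vwt_gt0 _ _)) // (mulrC (A i j)).
    by rewrite Asupp ?mulr0 ?mul0r //; apply: contraNN jG; apply/fintype.subsetP/sub.
  rewrite -mulr_sumr Asum -{2}(@sqr_sqrtr _ (ewt H i)) ?(ltW (ewt_gt0 _ _)) //.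
  by rewrite expr2 mulKf // sqrtr_eq0 -ltNge ewt_gt0.
rewrite -xx; apply: le_trans (dot_mulmx_le_opnorm_gram _ _).
rewrite dot_sum big_mkcond; apply: ler_sum => i _.
case: ifP => [iG|_]; last by rewrite -expr2 sqr_ge0.
by rewrite Ax // -expr2 sqr_sqrtr // ltW // ewt_gt0.
Qed.

(* Schur test: the rows of [A] weighted by [w] sum to [u], so Cauchy-Schwarz
   bounds the [i]-th entry of [tildemx A *m x] by [sum_j A i j * x_j^2]. *)
Lemma dot_tildemx_le A r x : support_matrices H A ->
  (forall j, \sum_i A i j <= r) ->
  dot (tildemx H A *m x) (tildemx H A *m x) <= r * dot x x.
Proof.
move=> [A0 _ Asum] Ar.
rewrite [leLHS]dot_sum.
apply: (@le_trans _ _ (\sum_i \sum_j A i j * x j 0 ^+ 2)); last first.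
  rewrite exchange_big dot_sum mulr_sumr /=; apply: ler_sum => j _.
  by rewrite -mulr_suml -expr2 ler_wpM2r ?sqr_ge0.
apply: ler_sum => i _; rewrite -expr2 mxE.
(* The factor [A i j] is split into two roots so that the row sum condition makes [p] a unit
   vector. *)
pose p j := (Num.sqrt (ewt H i))^-1 * Num.sqrt (A i j) * Num.sqrt (vwt H j).
pose q j := Num.sqrt (A i j) * x j 0.
have -> : \sum_j tildemx H A i j * x j 0 = \sum_j p j * q j.
  apply: eq_bigr => j _; rewrite tildemxE -{1}(sqr_sqrtr (A0 i j)) /p /q; ring.
apply: le_trans (cauchy_schwarz_sum _ _ _ _) _.
have -> : \sum_j p j ^+ 2 = 1.
  transitivity (\sum_j (ewt H i)^-1 * (vwt H j * A i j)).
    apply: eq_bigr => j _; rewrite !exprMn exprVn !sqr_sqrtr ?(ltW (ewt_gt0 _ _)) //.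
      by rewrite -mulrA (mulrC (A i j)).
    exact: ltW (vwt_gt0 _ _).
  by rewrite -mulr_sumr Asum mulVf // gt_eqF ?ewt_gt0.
rewrite mul1r; apply: ler_sum => j _.
by rewrite exprMn sqr_sqrtr.
Qed.

(** Vertex [j] gets capacity [r * vwt H j]; dividing the resulting flow by [vwt H j] turns it into a
    support matrix. *)
Lemma exists_support_matrix r : (forall i, supp H i != finset.set0) ->
  (forall G, is_subgraph H G -> G.1 != finset.set0 -> density H G <= r) ->
  exists2 A, support_matrices H A & forall j, \sum_i A i j <= r.
Proof.
move=> supp_neq0 Hr.
have [|S|f [f0 fsupp fu fw]] :=
    transportation _ _ _ (supp H) (ewt H) (fun j => r * vwt H j).
- by move=> i; apply: ltW (ewt_gt0 _ _).
(* The empty set bounds no density, but no hyperedge is supported in it. Otherwise Hall's condition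
   is the density bound for the subgraph induced on [S]. *)
- rewrite -mulr_sumr; have [->|S0] := eqVneq S finset.set0.
    rewrite big_set0 mulr0 /demand big1 // => i.
    by rewrite finset.subset0 (negbTE (supp_neq0 i)).
  rewrite -ler_pdivrMr ?vwt_sum_gt0 //.
  have := Hr (S, [set i | supp H i \subset S]%SET).
  rewrite /density /demand; under eq_bigl do rewrite finset.inE; apply=> //.
  by move=> i; rewrite finset.inE.
exists (\matrix_(i, j) (f i j / vwt H j)) => [|j]; first split=> [i j|i j ij|i].
- by rewrite mxE divr_ge0 // ltW // vwt_gt0.
- by rewrite mxE fsupp ?mul0r.
- rewrite -fu; apply: eq_bigr => j _.
  by rewrite mxE mulrC divfK // gt_eqF ?vwt_gt0.
under eq_bigr do rewrite mxE.
by rewrite -mulr_suml ler_pdivrMr ?vwt_gt0.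
Qed.
End Support.

Theorem theorem6 (R : realType) (n m : nat) (H : whypergraph R n m)
    (n_gt0 : (0 < n)%N)
    (vertex_covered : forall j : 'I_n, exists i : 'I_m, j \in supp H i)
    (supp_neq0 : forall i : 'I_m, supp H i != finset.set0) :
  (exists r : R,
     is_max [set density H G | G in
              [set G : {set 'I_n} * {set 'I_m} |
                 is_subgraph H G /\ G.1 != finset.set0]] r /\
     is_min [set opnorm ((tildemx H A)^T *m tildemx H A) | A in
              support_matrices H] r) /\
  (forall A : 'M[R]_(m, n), support_matrices H A ->
     is_max [set l : R | eigenvalue ((tildemx H A)^T *m tildemx H A) l]
            (opnorm ((tildemx H A)^T *m tildemx H A))).
Proof.
split=> [|A _]; last exact: opnorm_gram_max.
pose P (G : {set 'I_n} * {set 'I_m}) :=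
  [forall i in G.2, supp H i \subset G.1] && (G.1 != finset.set0).
have PP G : reflect (is_subgraph H G /\ G.1 != finset.set0) (P G).
  by apply: (iffP andP) => -[/forall_inP].
(* All vertices without hyperedges: the finite family of admissible subgraphs is non-empty, so a
   densest one exists. *)
have PT : P (finset.setT, finset.set0).
  apply/PP; split=> [i|]; first by rewrite finset.inE.
  by apply/finset.set0Pn; exists (Ordinal n_gt0); rewrite finset.inE.
have [G /PP[subG G0] Gmax] := arg_maxP (density H) PT.
have Gmax' G' : is_subgraph H G' -> G'.1 != finset.set0 -> density H G' <= density H G.
  by move=> sub' G'0; apply: Gmax; apply/PP.
exists (density H G); split.
  by split=> [|_ [G' [sub' G'0] <-]]; [exists G|exact: Gmax'].
split=> [|_ [A HA <-]]; last exact: density_le_opnorm.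
have [A HA Ar] := exists_support_matrix supp_neq0 Gmax'.
(* The Schur bound and the density bound meet at this [A], so the minimum is attained. *)
exists A => //; apply/eqP; rewrite eq_le density_le_opnorm // andbT.
by apply: opnorm_gram_le => // x; apply: dot_tildemx_le.
Qed.
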